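(* Let $\epsilon\in\{1,-1\}$, let $x$ be the semi-discrete minimal surface in $\mathbb{R}^3$ (if $\epsilon=1$) or semi-discrete maximal surface in $\mathbb{R}^{2,1}$ (if $\epsilon=-1$) determined by a semi-discrete holomorphic function $g$ with cross ratio factorizing functions $\tau(t),\sigma(k)$, and let $n$ be its normal. For $\theta\in\mathbb{R}$ let $x_\theta=x+\theta n$ be the parallel surface at oriented distance $\theta$, with principal curvatures $\kappa_{\theta}$ (on points) and $\kappa_{01,\theta}$, $\kappa_{-10,\theta}$ (on edges). Fix a point $(k_0,t_0)$ such that $(k_0-1,t_0),(k_0,t_0),(k_0+1,t_0)$ lie in the domain, and write $g_{-1}=g(k_0-1,t_0)$, $g=g(k_0,t_0)$, $g_1=g(k_0+1,t_0)$; if $\epsilon=-1$ assume that $|g_{-1}|,|g|,|g_1|$ are all different from $1$. Then: (i) The product $\kappa_{-10,\theta}\cdot\kappa_{01,\theta}$ at $(k_0,t_0)$ is nonpositive (meaning: it is negative, or at least one of the factors is infinite), i.e. $x_\theta(k_0,t_0)$ is a singular point with respect to the discrete direction, if and only if $$\theta\in[\min(a_{-1},a_1),\max(a_{-1},a_1)],$$ where $$a_{1}=\frac{-\sigma(k_0)(1+\epsilon|g|^2)(1+\epsilon|g_{1}|^2)}{4|g_1-g|^2},\qquad a_{-1}=\frac{-\sigma(k_0-1)(1+\epsilon|g|^2)(1+\epsilon|g_{-1}|^2)}{4|g-g_{-1}|^2}.$$ (ii) The product of the principal curvatures $\kappa_\theta$ at $(k_0,t_0)$ and at $(k_0+1,t_0)$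 is nonpositive (in the same sense), i.e. $x_\theta(k_0,t_0)$ is singular with respect to the smooth direction with regard to the edge $[x_\theta(k_0,t_0),x_\theta(k_0+1,t_0)]$, if and only if $$\theta\in[\min(b,b_1),\max(b,b_1)],$$ where $$b=\frac{-\tau(t_0)(1+\epsilon|g|^2)^2}{4|\partial g|^2},\qquad b_1=\frac{-\tau(t_0)(1+\epsilon|g_1|^2)^2}{4|\partial g_1|^2},$$ with $\partial g=\partial g(k_0,t_0)$, $\partial g_1=\partial g(k_0+1,t_0)$.
   Context: Semi-discrete maps are maps $y(k,t)$ on a subdomain of $\mathbb{Z}\times\mathbb{R}$, smooth in $t$; write $y=y(k,t)$, $y_1=y(k+1,t)$, $\partial y=\frac{d}{dt}y$, $\Delta y=y_1-y$. $\mathbb{R}^{2,1}$ is $\mathbb{R}^3$ with metric of signature $(+,+,-)$. A semi-discrete holomorphic function is a map $g(k,t)\in\mathbb{C}$ with $\partial g$ and $\Delta g$ never zero and $\dfrac{\partial g\,\partial g_1}{(\Delta g)^2}=\dfrac{\tau(t)}{\sigma(k)}<0$ for real-valued functions $\tau$ of $t$ and $\sigma$ of $k$ (the cross ratio factorizing functions). The semi-discrete minimal ($\epsilon=1$, in $\mathbb{R}^3$) or maximal ($\epsilon=-1$, in $\mathbb{R}^{2,1}$) surface determined by $g$ is a solution $x$ of $$\partial x=\mathrm{Re}\left(\frac{\tau}{2\partial g}\begin{pmatrix}1-\epsilon g^2\\ i(1+\epsilon g^2)\\ 2\epsilon g\end{pmatrix}\right),\qquad \Delta x=\mathrm{Re}\left(\frac{\sigma}{2\Delta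 g}\begin{pmatrix}1-\epsilon gg_1\\ i(1+\epsilon gg_1)\\ \epsilon(g+g_1)\end{pmatrix}\right),$$ with normal $$n=\frac{1}{1+\epsilon|g|^2}\begin{pmatrix}2\,\mathrm{Re}(g)\\ 2\,\mathrm{Im}(g)\\ -(1-\epsilon|g|^2)\end{pmatrix}.$$ The principal curvatures of $x_\theta$ (with normal $n$) are the scalars defined by $\partial n=-\kappa_\theta\,\partial x_\theta$ (at points $(k,t)$) and $\Delta n=-\kappa_{01,\theta}\,\Delta x_\theta$ (at edges joining $(k,t)$ and $(k+1,t)$); $\kappa_{-10,\theta}$ at $(k,t)$ denotes the edge principal curvature of the edge joining $(k-1,t)$ and $(k,t)$. A principal curvature is called infinite where $\partial x_\theta=0\neq\partial n$, respectively $\Delta x_\theta=0\ne\Delta n$. On a parallel surface $x_\theta$, a point $(k_0,t_0)$ is singular with respect to the discrete direction if $\kappa_{-10,\theta}\kappa_{01,\theta}<0$ at $(k_0,t_0)$ or at least one of these two is infinite. It is singular with respect to the smooth direction with regard to the edge $[x_\theta(k_0,t_0),x_\theta(k_0+1,t_0)]$ if the product of the values of $\kappa_\theta$ at $(k_0,t_0)$ and $(k_0+1,t_0)$ is negative or at least one of them is infinite. *)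

(* Defs.v *)
From HB Require Import structures.
From mathcomp Require Import all_boot all_order all_algebra.
From mathcomp Require Import all_classical all_reals all_analysis.
From mathcomp Require Import complex.
Set Implicit Arguments.
Unset Strict Implicit.
Unset Printing Implicit Defensive.
Import Order.TTheory GRing.Theory Num.Theory.
Import numFieldNormedType.Exports.
Import ComplexField.Normc.
Local Open Scope classical_set_scope.
Local Open Scope complex_scope.
Local Open Scope ring_scope.

(* A semi-discrete map on D, a subset of Z x R, is represented by a total
   function [int -> R -> V] whose values outside D are irrelevant. All time
   slices of D are open, so that derivatives in t at points of D depend only on
   the values on D. *)

Section SemiDiscrete.
Context {R : realType}.

Definition subdomain (D : set (int * R)) : Prop :=
  forall k : int, open [set t | D (k, t)].

Definition edge_in (D : set (int * R)) (k : int) (t : R) : Prop :=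
  D (k, t) /\ D (k + 1, t).

Definition smooth_on (V : normedModType R) (D : set (int * R))
    (y : int -> R -> V) : Prop :=
  forall (m : nat) (k : int) (t : R), D (k, t) ->
    derivable (derive1n m (y k)) t 1.

Definition dt (V : normedModType R) (y : int -> R -> V) (k : int) (t : R) : V :=
  derive1 (y k) t.

Definition dk (V : zmodType) (y : int -> R -> V) (k : int) (t : R) : V :=
  y (k + 1) t - y k t.

(* R[i] carries no [normedModType R] structure, hence the componentwise
   derivative and smoothness of a complex-valued function of a real variable. *)
Definition re_part (g : int -> R -> R[i]) (k : int) (t : R) : R :=
  complex.Re (g k t).
Definition im_part (g : int -> R -> R[i]) (k : int) (t : R) : R :=
  complex.Im (g k t).

Definition csmooth_on (D : set (int * R)) (g : int -> R -> R[i]) : Prop :=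
  smooth_on D (re_part g) /\ smooth_on D (im_part g).

Definition cdt (g : int -> R -> R[i]) (k : int) (t : R) : R[i] :=
  dt (re_part g) k t +i* dt (im_part g) k t.

Record sd_holomorphic (D : set (int * R)) (g : int -> R -> R[i])
    (tau : R -> R) (sigma : int -> R) : Prop := {
  sdh_smooth : csmooth_on D g;
  sdh_dt_neq0 : forall k t, D (k, t) -> cdt g k t != 0;
  sdh_dk_neq0 : forall k t, edge_in D k t -> dk g k t != 0;
  sdh_cross_ratio : forall k t, edge_in D k t ->
    cdt g k t * cdt g (k + 1) t / dk g k t ^+ 2 = (tau t / sigma k)%:C;
  sdh_cross_ratio_lt0 : forall k t, edge_in D k t -> tau t / sigma k < 0
}.

Definition vec3 (T : nmodType) (a b c : T) : 'cV[T]_3 :=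
  \col_(i < 3) [:: a; b; c]`_i.

Definition Re_vec (v : 'cV[R[i]]_3) : 'cV[R]_3 := map_mx (@complex.Re R) v.

(* The surface takes values in R^3 (eps = 1) or R^{2,1} (eps = -1). The two
   share the same underlying vector space 'cV[R]_3; the metric plays a role only
   through eps in the formulas below. *)
Record sd_surface (eps : R) (D : set (int * R)) (g : int -> R -> R[i])
    (tau : R -> R) (sigma : int -> R) (x : int -> R -> 'cV[R]_3) : Prop := {
  sds_smooth : smooth_on D x;
  sds_dt : forall k t, D (k, t) ->
    dt x k t =
      Re_vec (((tau t)%:C / (2 * cdt g k t)) *:
        vec3 (1 - eps%:C * g k t ^+ 2)
             ('i%C * (1 + eps%:C * g k t ^+ 2))
             (2 * eps%:C * g k t));
  sds_dk : forall k t, edge_in D k t ->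
    dk x k t =
      Re_vec (((sigma k)%:C / (2 * dk g k t)) *:
        vec3 (1 - eps%:C * (g k t * g (k + 1) t))
             ('i%C * (1 + eps%:C * (g k t * g (k + 1) t)))
             (eps%:C * (g k t + g (k + 1) t)))
}.

Definition sd_normal (eps : R) (g : int -> R -> R[i]) (k : int) (t : R) :
    'cV[R]_3 :=
  (1 + eps * normc (g k t) ^+ 2)^-1 *:
    vec3 (2 * complex.Re (g k t))
         (2 * complex.Im (g k t))
         (- (1 - eps * normc (g k t) ^+ 2)).

Definition parallel_surface (x n : int -> R -> 'cV[R]_3) (theta : R)
    (k : int) (t : R) : 'cV[R]_3 :=
  x k t + theta *: n k t.

(* Principal curvatures of a surface y with normal n. The edge joining (k, t)
   and (k + 1, t) is indexed by k, so that kappa_{01} and kappa_{-10} at (k, t)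
   are the curvatures of the edges k and k - 1. The conditions [dt y k t != 0]
   and [dk y k t != 0] are what makes the scalar kappa unique. *)
Section Curvatures.
Variables (y n : int -> R -> 'cV[R]_3).

Definition point_curvature (k : int) (t kappa : R) : Prop :=
  dt y k t != 0 /\ dt n k t = - (kappa *: dt y k t).

Definition point_curvature_infinite (k : int) (t : R) : Prop :=
  dt y k t = 0 /\ dt n k t != 0.

Definition edge_curvature (k : int) (t kappa : R) : Prop :=
  dk y k t != 0 /\ dk n k t = - (kappa *: dk y k t).

Definition edge_curvature_infinite (k : int) (t : R) : Prop :=
  dk y k t = 0 /\ dk n k t != 0.

Definition singular_discrete (k : int) (t : R) : Prop :=
  (exists kappa_m10 kappa_01 : R,
     [/\ edge_curvature (k - 1) t kappa_m10,
         edge_curvature k t kappa_01 &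
         kappa_m10 * kappa_01 < 0]) \/
  (edge_curvature_infinite (k - 1) t \/ edge_curvature_infinite k t).

Definition singular_smooth (k : int) (t : R) : Prop :=
  (exists kappa kappa_1 : R,
     [/\ point_curvature k t kappa,
         point_curvature (k + 1) t kappa_1 &
         kappa * kappa_1 < 0]) \/
  (point_curvature_infinite k t \/ point_curvature_infinite (k + 1) t).

End Curvatures.

End SemiDiscrete.

(* Main.v *)
(* On each edge and at each point the normal and the surface are parallel:
   [dk x = - a *: dk n] and [dt x = - b *: dt n], where [a] and [b] are explicit
   because [n] is the stereographic image of [g].  Hence [x + theta n] has
   differences [(theta - a) *: dk n] and derivatives [(theta - b) *: dt n], that
   is, principal curvatures [1 / (a - theta)] and [1 / (b - theta)], infinite
   exactly at [theta = a] and [theta = b] since [dk n] and [dt n] never vanish.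
   A product of two such curvatures is negative iff theta lies strictly between
   the two focal distances. *)
Require Import Defs.
From HB Require Import structures.
From mathcomp Require Import all_boot all_order all_algebra.
From mathcomp Require Import all_classical all_reals all_analysis.
From mathcomp Require Import complex.
From mathcomp Require Import ring lra.
Set Implicit Arguments.
Unset Strict Implicit.
Unset Printing Implicit Defensive.
Import Order.TTheory GRing.Theory Num.Theory.
Import numFieldNormedType.Exports.
Import ComplexField.Normc.
Local Open Scope classical_set_scope.
Local Open Scope complex_scope.
Local Open Scope ring_scope.

(** * Coordinates of triples and real parts of complex quotients *)

Lemma vec3P (T : nmodType) (v : 'cV[T]_3) (a b c : T) :
  v (inord 0) 0 = a -> v (inord 1) 0 = b -> v (inord 2) 0 = c -> v = vec3 a b c.
Proof.
move=> va vb vc; apply/colP => i; rewrite mxE.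
by case: i => [[|[|[|//]]]] ilt /=; rewrite -?va -?vb -?vc; congr (v _ _);
  apply/val_inj; rewrite /= inordK.
Qed.

Lemma vec3_inj (T : nmodType) (a b c a' b' c' : T) :
  vec3 a b c = vec3 a' b' c' -> [/\ a = a', b = b' & c = c'].
Proof.
move=> /colP e; have := (e (inord 0), e (inord 1), e (inord 2)).
by rewrite !mxE !inordK//= => -[[]].
Qed.

Lemma scale_vec3 (T : pzRingType) (r a b c : T) :
  r *: vec3 a b c = vec3 (r * a) (r * b) (r * c).
Proof. by apply: vec3P; rewrite !mxE inordK. Qed.

Lemma sub_vec3 (T : zmodType) (a b c a' b' c' : T) :
  vec3 a b c - vec3 a' b' c' = vec3 (a - a') (b - b') (c - c').
Proof. by apply: vec3P; rewrite !mxE inordK. Qed.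

Lemma vec3_eq0 (T : nmodType) (a b c : T) :
  vec3 a b c = 0 -> [/\ a = 0, b = 0 & c = 0].
Proof.
by move=> e; apply: vec3_inj; rewrite e; apply: vec3P; rewrite mxE.
Qed.

Lemma Re_vec3 (R : realType) (a b c : R[i]) :
  Re_vec (vec3 a b c) = vec3 (complex.Re a) (complex.Re b) (complex.Re c).
Proof. by apply: vec3P; rewrite !mxE inordK. Qed.

Lemma sqr_normc (R : rcfType) (z : R[i]) :
  normc z ^+ 2 = complex.Re z ^+ 2 + complex.Im z ^+ 2.
Proof. by case: z => a b; rewrite /= sqr_sqrtr// addr_ge0 ?sqr_ge0. Qed.

Lemma sqr_normc_neq0 (R : rcfType) (z : R[i]) : z != 0 -> normc z ^+ 2 != 0.
Proof.
by rewrite sqrf_eq0; apply: contra_neq => /eq0_normc.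
Qed.

(** Since [1 / z] is the conjugate of [z] over [|z|^2], a planar inner product appears; the formulas
    defining [x] thus become real rational expressions. *)
Lemma Re_div_double_mul (R : rcfType) (r : R) (z u : R[i]) :
  complex.Re (r%:C / (2 * z) * u) =
  r / (2 * normc z ^+ 2) *
    (complex.Re z * complex.Re u + complex.Im z * complex.Im u).
Proof.
have -> : 2 = (2 : R)%:C by rewrite rmorph_nat.
rewrite sqr_normc invfM -fmorphV.
case: z u => a b [c d] /=.
rewrite invfM.
ring.
Qed.

(** * Derivatives of quotients and of triples *)

Lemma is_derive_div (R : realType) (f h : R -> R) (t df dh : R) :
  h t != 0 -> is_derive t 1 f df -> is_derive t 1 h dh ->
  is_derive t 1 (fun s => f s / h s) ((df * h t - f t * dh) / h t ^+ 2).
Proof.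
move=> h0 fd hd.
have hV : is_derive t 1 (fun s => (h s)^-1) (- (h t) ^- 2 *: dh).
  have dh1 : derivable h t 1 by exact: ex_derive.
  by apply: DeriveDef; [exact: derivableV | rewrite deriveV// derive_val].
have scaleE (a b : R) : a *: b = a * b by [].
have := is_deriveM fd hV; rewrite (_ : f * _ = (fun s => f s / h s)) // !scaleE.
move/is_derive_eq; apply.
by field.
Qed.

Lemma is_derive_one_add_sum_sqr (R : realType) (eps : R) (p q : R -> R)
    (t dp dq : R) :
  is_derive t 1 p dp -> is_derive t 1 q dq ->
  is_derive t 1 (cst 1 + eps *: (p ^+ 2 + q ^+ 2))
    (eps * (2 * (p t * dp + q t * dq))).
Proof.
move=> hp hq; have scaleE (a b : R) : a *: b = a * b by [].
have := is_deriveD (is_derive_cst (1 : R) t 1)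
  (is_deriveZ eps (is_deriveD (is_deriveX 2 hp) (is_deriveX 2 hq))).
move/is_derive_eq; apply.
by rewrite add0r !scaleE /= !expr1; ring.
Qed.

Lemma is_derive_vec3 (R : realType) (f1 f2 f3 : R -> R) (t d1 d2 d3 : R) :
  is_derive t 1 f1 d1 -> is_derive t 1 f2 d2 -> is_derive t 1 f3 d3 ->
  is_derive t 1 (fun s => vec3 (f1 s) (f2 s) (f3 s)) (vec3 d1 d2 d3).
Proof.
move=> h1 h2 h3.
have dv : derivable (fun s => vec3 (f1 s) (f2 s) (f3 s)) t 1.
  apply/derivable_mxP => i j; under eq_fun do rewrite mxE.
  by case: i => [[|[|[|//]]]] /= _; exact: ex_derive.
apply: DeriveDef => //; rewrite derive_mx//.
apply/matrixP => i j; rewrite !mxE; under eq_fun do rewrite mxE.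
by case: i => [[|[|[|//]]]] /= _; exact: derive_val.
Qed.

(** * Sign of a product of two curvatures *)

Section SingularInterval.
Variables (R : realType) (V : lmodType R).
Implicit Types (u v : V) (a b theta : R).

(** Comparing the coefficients of [u] gives [1 = kappa * (a - theta)]. *)
Lemma scaled_curvatureP u a theta kappa : u != 0 ->
  ((theta - a) *: u != 0 /\ u = - (kappa *: ((theta - a) *: u))) <->
  (theta != a /\ kappa = (a - theta)^-1).
Proof.
move=> u0; split=> [[]|[ta ->]].
  rewrite scaler_eq0 negb_or subr_eq0 => /andP[ta _] ue; split=> //.
  have /eqP : (1 - kappa * (a - theta)) *: u = 0.
    by rewrite scalerBl scale1r -scalerA -(opprB theta) scaleNr scalerN opprK
      {1}ue addNr.
  rewrite scaler_eq0 (negPf u0) orbF subr_eq0 => /eqP e.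
  by rewrite -[LHS]mulr1 -[1](@divff _ (a - theta)) ?subr_eq0 1?eq_sym// mulrA -e mul1r.
split; first by rewrite scaler_eq0 negb_or subr_eq0 ta.
by rewrite scalerA -(opprB a) mulrN mulVf ?scaleN1r ?opprK// subr_eq0 eq_sym.
Qed.

(** Kept in the unfolded shape of [singular_discrete] and [singular_smooth], with [u] and [v]
    standing for increments or derivatives of the normal. If [a = b], only the infinite case can
    occur. *)
Lemma singular_interval u v a b theta : u != 0 -> v != 0 ->
  ((exists ka kb : R,
     [/\ (theta - a) *: u != 0 /\ u = - (ka *: ((theta - a) *: u)),
         (theta - b) *: v != 0 /\ v = - (kb *: ((theta - b) *: v)) &
         ka * kb < 0]) \/
   (((theta - a) *: u = 0 /\ u != 0) \/ ((theta - b) *: v = 0 /\ v != 0))) <->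
  theta \in `[Num.min a b, Num.max a b].
Proof.
move=> u0 v0; rewrite in_itv /= ge_min le_max.
split=> [[[ka [kb []]]|]|].
- move=> /(scaled_curvatureP _ _ _ u0)[ta ->] /(scaled_curvatureP _ _ _ v0)[tb ->].
  rewrite -invfM invr_lt0; nra.
- case=> -[/eqP]; rewrite scaler_eq0 subr_eq0 => /orP[/eqP <-|/eqP ->];
    by rewrite ?eqxx ?lexx ?orbT.
- move=> h; have [->|ta] := eqVneq theta a.
    by right; left; rewrite subrr scale0r.
  have [->|tb] := eqVneq theta b.
    by right; right; rewrite subrr scale0r.
  left; exists (a - theta)^-1, (b - theta)^-1; split.
  + by apply/scaled_curvatureP.
  + by apply/scaled_curvatureP.
  (* With both endpoints excluded, the bounds on [theta] are strict, so [a - theta] and [b - theta]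
     have opposite signs. *)
  rewrite -invfM invr_lt0; move: ta tb; rewrite !neq_lt; nra.
Qed.

End SingularInterval.

Lemma dt_parallel_surface (R : realType) (x n : int -> R -> 'cV[R]_3) theta k t :
  derivable (x k) t 1 -> derivable (n k) t 1 ->
  dt (parallel_surface x n theta) k t = dt x k t + theta *: dt n k t.
Proof.
move=> /derivableP hx /derivableP hn; rewrite /dt !derive1E.
exact: (@derive_val _ _ _ _ _ _ _ (is_deriveD hx (is_deriveZ theta hn))).
Qed.

(** * Proportionality of the changes of surface and normal *)

Section Surface.
Variables (R : realType) (eps : R) (D : set (int * R)) (g : int -> R -> R[i]).
Variables (tau : R -> R) (sigma : int -> R) (x : int -> R -> 'cV[R]_3).
Hypotheses (hg : sd_holomorphic D g tau sigma)
  (hx : sd_surface eps D g tau sigma x).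

Local Notation w k t := (1 + eps * normc (g k t) ^+ 2).
Local Notation n := (sd_normal eps g).

Lemma sd_normalE k t :
  n k t = vec3 (2 * complex.Re (g k t) / w k t) (2 * complex.Im (g k t) / w k t)
               ((w k t - 2) / w k t).
Proof.
rewrite /sd_normal scale_vec3; congr vec3; rewrite 1?mulrC//.
by congr (_ / _); ring.
Qed.

Lemma sd_normal_inj k l t : w k t != 0 -> w l t != 0 ->
  n k t = n l t -> g k t = g l t.
Proof.
move=> wk wl; rewrite !sd_normalE => /vec3_inj[].
move=> hre him; rewrite !mulrBl !divff// => /subrI.
have two0 : (2 : R) != 0 by rewrite pnatr_eq0.
move=> /(mulfI two0)/invr_inj e; move: hre him; rewrite e.
move=> /(divIf wl)/(mulfI two0) + /(divIf wl)/(mulfI two0).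
by case: (g k t) (g l t) => a b [c d] /= -> ->.
Qed.

(* The reciprocal of the principal curvature of [x] on the edge [k]: a_1 is its
   value on the edge [k0], a_{-1} its value on the edge [k0 - 1]. *)
Definition edge_distance k t : R :=
  - sigma k * w k t * w (k + 1) t / (4 * normc (dk g k t) ^+ 2).

(** Smooth counterpart of [edge_distance]: [b] and [b1] are its values at [k0] and [k0 + 1]. *)
Definition point_distance k t : R :=
  - tau t * w k t ^+ 2 / (4 * normc (cdt g k t) ^+ 2).

(** The conjugate of [g_1 - g] times [g g_1] is [|g_1|^2 g - |g|^2 g_1], a term that also arises
    when [g_1 / w_1 - g / w] is put over the denominator [w w_1]. *)
Lemma dk_parallel theta k t : edge_in D k t -> w k t != 0 -> w (k + 1) t != 0 ->
  dk (parallel_surface x n theta) k t = (theta - edge_distance k t) *: dk n k t.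
Proof.
move=> Dk w0 w1.
have -> : dk (parallel_surface x n theta) k t = dk x k t + theta *: dk n k t.
  by rewrite /dk /parallel_surface scalerBr addrACA -opprD.
rewrite scalerBl addrC; congr (_ + _).
have d0 := sqr_normc_neq0 (sdh_dk_neq0 hg Dk).
rewrite (sds_dk hx Dk) scale_vec3 Re_vec3 !Re_div_double_mul.
rewrite [dk n k t]/dk !sd_normalE sub_vec3 -scaleNr scale_vec3 /edge_distance.
move: d0 w0 w1; rewrite !sqr_normc /dk.
case: (g k t) (g (k + 1) t) => a b [c d] /= d0 w0 w1.
by congr vec3; field; rewrite w0 w1 d0.
Qed.

Lemma is_derive_sd_normal k t : D (k, t) -> w k t != 0 ->
  let p := re_part g k t in let q := im_part g k t in
  let dp : R := dt (re_part g) k t in let dq : R := dt (im_part g) k t in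
  let dw := eps * (2 * (p * dp + q * dq)) in
  is_derive t 1 (n k)
    (vec3 (2 * (dp * w k t - p * dw) / w k t ^+ 2)
          (2 * (dq * w k t - q * dw) / w k t ^+ 2)
          (2 * dw / w k t ^+ 2)).
Proof.
move=> Dk w0 p q dp dq dw.
have [hre him] := sdh_smooth hg.
have hp : is_derive t 1 (re_part g k) dp.
  (* Order [0] of [smooth_on] is derivability of the function itself. *)
  by apply: DeriveDef; [exact: (hre 0 _ _ Dk) | rewrite -derive1E].
have hq : is_derive t 1 (im_part g k) dq.
  by apply: DeriveDef; [exact: (him 0 _ _ Dk) | rewrite -derive1E].
have hw : is_derive t 1 (fun s => w k s) dw.
  have -> : (fun s => w k s) =
      cst 1 + eps *: (re_part g k ^+ 2 + im_part g k ^+ 2).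
    by apply/funext => s; rewrite sqr_normc.
  exact: is_derive_one_add_sum_sqr.
have h2 (f : R -> R) df :
    is_derive t 1 f df -> is_derive t 1 (fun s => 2 * f s) (2 * df).
  by move=> fd; exact: (is_deriveZ 2 fd).
have hw2 : is_derive t 1 (fun s => w k s - 2) dw.
  have -> : (fun s => w k s - 2) = (fun s => w k s) - cst 2 by [].
  by apply: is_derive_eq; rewrite subr0.
have := is_derive_vec3 (is_derive_div (h := fun s => w k s) w0 (h2 _ _ hp) hw)
  (is_derive_div (h := fun s => w k s) w0 (h2 _ _ hq) hw)
  (is_derive_div (h := fun s => w k s) w0 hw2 hw).
rewrite (_ : (fun s => vec3 _ _ _) = n k); last first.
  by apply/funext => s; rewrite sd_normalE.
move/is_derive_eq; apply; congr vec3; congr (_ / _); rewrite /p /q; ring.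
Qed.

(** Infinitesimal form of [sd_normal_inj]: a vanishing last coordinate forces [w' = 0], and the
    other two then give [g' = 0]. *)
Lemma dt_sd_normal_neq0 k t : D (k, t) -> w k t != 0 -> eps != 0 ->
  dt n k t != 0.
Proof.
move=> Dk w0 e0; have := is_derive_sd_normal Dk w0.
move: (re_part g k t) (im_part g k t) => p q /= hn.
rewrite /dt derive1E (@derive_val _ _ _ _ _ _ _ hn).
have := sdh_dt_neq0 hg Dk; rewrite /cdt.
move: (dt (re_part g) k t : R) (dt (im_part g) k t : R) => dp dq /= d0.
have iw : (w k t ^+ 2)^-1 != 0 by rewrite invr_eq0 sqrf_eq0.
apply/eqP => /vec3_eq0[/eqP + /eqP + /eqP].
rewrite !mulf_eq0 (negPf iw) (negPf e0) !pnatr_eq0 /= !orbF => + + /eqP e.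
rewrite (e : p * dp + q * dq = 0).
rewrite !mulr0 !subr0 !mulf_eq0 (negPf w0) !orbF => /eqP dp0 /eqP dq0.
by move: d0; rewrite dp0 dq0 eqxx.
Qed.

(** Over [w^2], the derivative of [g / w] has numerator [g' - eps g^2 conj(g')], whose real part is
    that of [conj(g') (1 - eps g^2)]. *)
Lemma dt_parallel theta k t : D (k, t) -> w k t != 0 ->
  dt (parallel_surface x n theta) k t = (theta - point_distance k t) *: dt n k t.
Proof.
move=> Dk w0; have hn := is_derive_sd_normal Dk w0.
have -> : dt (parallel_surface x n theta) k t = dt x k t + theta *: dt n k t.
  have hs : smooth_on D x := sds_smooth hx.
  by apply: dt_parallel_surface; [exact: (hs 0 _ _ Dk) | exact: ex_derive].
rewrite scalerBl addrC; congr (_ + _).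
have d0 := sqr_normc_neq0 (sdh_dt_neq0 hg Dk).
rewrite (sds_dt hx Dk) scale_vec3 Re_vec3 !Re_div_double_mul.
rewrite [dt n k t]derive1E (@derive_val _ _ _ _ _ _ _ hn).
rewrite -scaleNr scale_vec3 /point_distance.
rewrite -[re_part g k t]/(complex.Re (g k t)) -[im_part g k t]/(complex.Im (g k t)).
move: d0 w0; rewrite !sqr_normc /cdt.
move: (dt (re_part g) k t : R) (dt (im_part g) k t : R) => c d.
case: (g k t) => a b /= d0 w0.
by congr vec3; field; rewrite w0 d0.
Qed.

End Surface.

Theorem theorem5p1 (R : realType) (eps : R) (heps : eps = 1 \/ eps = -1)
    (D : set (int * R)) (hD : subdomain D)
    (g : int -> R -> R[i]) (tau : R -> R) (sigma : int -> R)
    (hg : sd_holomorphic D g tau sigma)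
    (x : int -> R -> 'cV[R]_3) (hx : sd_surface eps D g tau sigma x)
    (theta : R) (k0 : int) (t0 : R)
    (hm1 : D (k0 - 1, t0)) (h0 : D (k0, t0)) (h1 : D (k0 + 1, t0))
    (hnorm : eps = -1 ->
       [/\ normc (g (k0 - 1) t0) != 1, normc (g k0 t0) != 1
         & normc (g (k0 + 1) t0) != 1]) :
  let n := sd_normal eps g in
  let xtheta := parallel_surface x n theta in
  let gm1 := g (k0 - 1) t0 in
  let g0 := g k0 t0 in
  let g1 := g (k0 + 1) t0 in
  let a1 := - sigma k0 * (1 + eps * normc g0 ^+ 2) * (1 + eps * normc g1 ^+ 2)
            / (4 * normc (g1 - g0) ^+ 2) in
  let am1 := - sigma (k0 - 1) * (1 + eps * normc g0 ^+ 2)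
               * (1 + eps * normc gm1 ^+ 2)
             / (4 * normc (g0 - gm1) ^+ 2) in
  let b := - tau t0 * (1 + eps * normc g0 ^+ 2) ^+ 2
           / (4 * normc (cdt g k0 t0) ^+ 2) in
  let b1 := - tau t0 * (1 + eps * normc g1 ^+ 2) ^+ 2
            / (4 * normc (cdt g (k0 + 1) t0) ^+ 2) in
  (singular_discrete xtheta n k0 t0
     <-> theta \in `[Num.min am1 a1, Num.max am1 a1]) /\
  (singular_smooth xtheta n k0 t0
     <-> theta \in `[Num.min b b1, Num.max b b1]).
Proof.
move=> n xtheta gm1 g0 g1 a1 am1 b b1.
have e0 : eps != 0 by case: heps => ->; rewrite ?oppr_eq0 oner_eq0.
have w0 k : (eps = -1 -> normc (g k t0) != 1) ->
    1 + eps * normc (g k t0) ^+ 2 != 0.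
  case: heps => -> h; first by rewrite mul1r gt_eqF// ltr_wpDr ?sqr_ge0.
  (* [|g|^2 = 1] would also allow [|g| = -1], excluded by nonnegativity of the modulus. *)
  rewrite mulN1r subr_eq0 eq_sym sqrf_eq1 negb_or h//=.
  rewrite gt_eqF// (@lt_le_trans _ _ 0) ?oppr_lt0//.
  by case: (g k t0) => *; exact: sqrtr_ge0.
have wm1 := w0 _ (fun h => let: And3 H _ _ := hnorm h in H).
have w00 := w0 _ (fun h => let: And3 _ H _ := hnorm h in H).
have w1 := w0 _ (fun h => let: And3 _ _ H := hnorm h in H).
have em1 : edge_in D (k0 - 1) t0 by split; rewrite ?subrK.
have e1 : edge_in D k0 t0 by [].
have dkn k : edge_in D k t0 -> 1 + eps * normc (g k t0) ^+ 2 != 0 ->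
    1 + eps * normc (g (k + 1) t0) ^+ 2 != 0 -> dk n k t0 != 0.
  (* Equal normals at both ends of an edge would make [dk g] vanish. *)
  move=> Dk wk wk1; have := sdh_dk_neq0 hg Dk; rewrite !subr_eq0.
  by apply: contra_neq => /(sd_normal_inj wk1 wk).
split.
- rewrite /singular_discrete /edge_curvature /edge_curvature_infinite.
  rewrite !(dk_parallel hg hx)// ?subrK//.
  (* [am1] lists the factor at [k0] before the one at [k0 - 1], the reverse of [edge_distance]. *)
  have -> : am1 = edge_distance eps g sigma (k0 - 1) t0.
    by rewrite /am1 /edge_distance /dk subrK (mulrAC (- sigma _)).
  by apply: singular_interval; apply: dkn; rewrite ?subrK.
- rewrite /singular_smooth /point_curvature /point_curvature_infinite.
  rewrite !(dt_parallel hg hx)//.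
  by apply: singular_interval; apply: (dt_sd_normal_neq0 hg).
Qed.
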